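(* Let $GL_{-}(n,\mathbb{R})=\{A\in GL(n,\mathbb{R}):\det A<0\}$ and $GL_{+}(n,\mathbb{R})=\{A\in GL(n,\mathbb{R}):\det A>0\}$. Then $GL_{-}(n,\mathbb{R})$ has a structure of group which is isomorphic, as a group, onto $GL_{+}(n,\mathbb{R})$ (with the usual matrix multiplication).
   Context: $GL(n,\mathbb{R})$ is the group of invertible real $n\times n$ matrices. The group structure on the set $GL_{-}(n,\mathbb{R})$ is a new composition law, not the restriction of matrix multiplication (under which $GL_{-}(n,\mathbb{R})$ is not closed). *)

(* Defs.v *)
From HB Require Import structures.
From mathcomp Require Import all_boot all_order all_algebra.
From mathcomp Require Import reals.

Set Implicit Arguments.
Unset Strict Implicit.
Unset Printing Implicit Defensive.

Import Order.TTheory GRing.Theory Num.Theory.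
Local Open Scope ring_scope.

(* MathComp's own general linear group 'GL_n[R] requires a finite coefficient
   ring, so GL(n, R) is set up here on top of unitmx. *)
Section GeneralLinearGroup.
Variables (R : realType) (n : nat).

Record GL := MkGL { GL_mx :> 'M[R]_n; GL_unitmx : GL_mx \in unitmx }.

HB.instance Definition _ := [isSub for GL_mx].
HB.instance Definition _ := [Choice of GL by <:].

Definition GL1 : GL := MkGL (unitmx1 R n).

Fact GLV_unitmx (A : GL) : invmx A \in unitmx.
Proof. by rewrite unitmx_inv GL_unitmx. Qed.
Definition GLV (A : GL) : GL := MkGL (GLV_unitmx A).

Fact GLM_unitmx (A B : GL) : A *m B \in unitmx.
Proof. by rewrite unitmx_mul !GL_unitmx. Qed.
Definition GLM (A B : GL) : GL := MkGL (GLM_unitmx A B).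

Fact GLMA : associative GLM.
Proof. by move=> A B C; apply: val_inj; rewrite /= mulmxA. Qed.
Fact GLM1l : left_id GL1 GLM.
Proof. by move=> A; apply: val_inj; rewrite /= mul1mx. Qed.
Fact GLM1r : right_id GL1 GLM.
Proof. by move=> A; apply: val_inj; rewrite /= mulmx1. Qed.
Fact GLMVl : left_inverse GL1 GLV GLM.
Proof. by move=> A; apply: val_inj; rewrite /= mulVmx // GL_unitmx. Qed.
Fact GLMVr : right_inverse GL1 GLV GLM.
Proof. by move=> A; apply: val_inj; rewrite /= mulmxV // GL_unitmx. Qed.

HB.instance Definition _ := isGroup.Build GL GLMA GLM1l GLM1r GLMVl GLMVr.

Definition posdet : pred GL := fun A => 0 < \det A.
Definition negdet : pred GL := fun A => \det A < 0.

Record GLplus := MkGLplus { GLplus_val :> GL; GLplus_posdet : posdet GLplus_val }.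

HB.instance Definition _ := [isSub for GLplus_val].
HB.instance Definition _ := [Choice of GLplus by <:].

Fact posdet_group_closed : group_closed posdet.
Proof.
split=> [|A B]; rewrite !unfold_in /=; first by rewrite det1 ltr01.
by move=> A0 B0; rewrite det_mulmx det_inv mulr_gt0 ?invr_gt0.
Qed.

(* Multiplication on GLplus is inherited from GL; GLminus, not being closed
   under it, only receives the structure of a set. *)
HB.instance Definition _ :=
  SubChoice_isSubGroup.Build GL posdet GLplus posdet_group_closed.

Record GLminus :=
  MkGLminus { GLminus_val :> GL; GLminus_negdet : negdet GLminus_val }.

HB.instance Definition _ := [isSub for GLminus_val].
HB.instance Definition _ := [Choice of GLminus by <:].

End GeneralLinearGroup.

(* A group law on the given carrier T, with no relation to any operation T may
   already have; group_of turns it into a groupType whose carrier is T. *)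
Definition group_structure (T : Type) : Type := monoid.Group.axioms_ T.

Definition group_of (T : Type) (s : group_structure T) : groupType :=
  monoid.Group.Pack s.

Definition group_isomorphic (G H : groupType) : Prop :=
  exists f : {multiplicative G -> H}, bijective f.

(* Main.v *)
(* Left multiplication by a fixed matrix D with det D < 0 is a bijection from
   GL_-(n, R) onto GL_+(n, R); transporting the matrix product along it gives
   the group law A * B := D^-1 (D A) (D B) = A D B on GL_-(n, R), with unit
   D^-1. *)

Require Import Defs.
From HB Require Import structures.
From mathcomp Require Import all_boot all_order all_algebra.
From mathcomp Require Import reals.

Set Implicit Arguments.
Unset Strict Implicit.
Unset Printing Implicit Defensive.

Import Order.TTheory GRing.Theory Num.Theory.

Section TransportedGroup.
Variables (T : Type) (G : groupType) (f : T -> G) (g : G -> T).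
Hypotheses (fK : cancel f g) (gK : cancel g f).
Local Open Scope group_scope.

(* The two proofs are phantom arguments of the type, so that its instances can
   depend on them. *)
Definition transported of cancel f g & cancel g f : Type := T.
Local Notation U := (transported fK gK).

Let one : U := g 1.
Let inv (x : U) : U := g (f x)^-1.
Let mul (x y : U) : U := g (f x * f y).

Fact transported_mulA : associative mul.
Proof. by move=> x y z; rewrite /mul !gK mulgA. Qed.
Fact transported_mul1g : left_id one mul.
Proof. by move=> x; rewrite /mul gK mul1g fK. Qed.
Fact transported_mulg1 : right_id one mul.
Proof. by move=> x; rewrite /mul gK mulg1 fK. Qed.
Fact transported_mulVg : left_inverse one inv mul.
Proof. by move=> x; rewrite /mul gK mulVg. Qed.
Fact transported_mulgV : right_inverse one inv mul.
Proof. by move=> x; rewrite /mul gK mulgV. Qed.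

(** A [groupType] carries equality and choice, while [T] is a bare type, so both are pulled back
    from [G] along the injective [f]. *)
HB.instance Definition _ := Choice.copy U (can_type fK).
HB.instance Definition _ := isGroup.Build U transported_mulA
  transported_mul1g transported_mulg1 transported_mulVg transported_mulgV.

Definition untransport (x : U) : G := f x.

Fact untransportM : {morph untransport : x y / x * y}.
(* By definition [x * y] in [U] is [g (f x * f y)]. *)
Proof. by move=> x y; apply: gK. Qed.

HB.instance Definition _ := isMultiplicative.Build U G untransport untransportM.

Lemma group_structure_transport :
  exists s : group_structure T, group_isomorphic (group_of s) G.
Proof.
(* [U] unfolds to [T], so the class found on [U] is a group structure on [T] itself. *)
by exists (Group.class U), untransport; exists g; [apply: fK | apply: gK].
Qed.

End TransportedGroup.

Local Open Scope ring_scope.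

(** The witness is diagonal, with one entry [a] and the others 1. The only 0 by 0 matrix has
    determinant 1, hence [0 < n]. *)
Lemma exists_GL_det (R : realType) (n : nat) (a : R) :
  (0 < n)%N -> a != 0 -> exists D : GL R n, \det D = a.
Proof.
move=> n_gt0 a_neq0; pose i0 := Ordinal n_gt0.
pose D : 'M[R]_n := diag_mx (\row_i if i == i0 then a else 1).
have detD : \det D = a.
  rewrite det_diag (bigD1 i0) //= big1 => [|i /negPf i_neq0].
    by rewrite mxE eqxx mulr1.
  by rewrite mxE i_neq0.
have unitD : D \in unitmx by rewrite unitmxE detD unitfE.
by exists (MkGL unitD).
Qed.

(** Multiplying by [D] flips the sign of the determinant, and so does multiplying by [D^-1], whose
    determinant is again negative. *)
Lemma GLminus_GLplus_bijection (R : realType) (n : nat) (D : GL R n) :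
  \det D < 0 ->
  exists (f : GLminus R n -> GLplus R n) (g : GLplus R n -> GLminus R n),
    cancel f g /\ cancel g f.
Proof.
move=> D_lt0.
have fP (A : GLminus R n) : posdet (D * A)%g.
  by rewrite /posdet /= det_mulmx nmulr_rgt0 //; apply: GLminus_negdet.
have gP (B : GLplus R n) : negdet (D^-1 * B)%g.
  rewrite /negdet /= det_mulmx det_inv nmulr_rlt0 ?invr_lt0 //.
  exact: GLplus_posdet.
exists (fun A => MkGLplus (fP A)), (fun B => MkGLminus (gP B)).
by split=> A; apply: val_inj; [apply: mulKg | apply: mulVKg].
Qed.

Theorem theorem6p1 (R : realType) (n : nat) (n_gt0 : (0 < n)%N) :
  exists s : group_structure (GLminus R n),
    group_isomorphic (group_of s) (GLplus R n).
Proof.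
(* Any negative determinant would serve in place of -1. *)
have [|D detD] := @exists_GL_det R n (-1) n_gt0.
  by rewrite oppr_eq0 oner_eq0.
have [|f [g [fK gK]]] := @GLminus_GLplus_bijection R n D.
  by rewrite detD oppr_lt0 ltr01.
exact: group_structure_transport fK gK.
Qed.
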